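(* Let $n,r,s\ge 1$ be integers and let $k$ be defined by $2k+1=(2r+1)(2s+1)$. For $1\le a\le r$, set $I_a=\{(a-1)(2s+1)+1,\dots,a(2s+1)\}$, and set $M=\{r(2s+1)+1,\dots,(r+1)(2s+1)\}$. Let $G_{2n}(2r+1,2s+1)$ be the simple graph with vertex set $$\{u_i,v_i: 1\le i\le 2k+1\}\cup\{Y_{a,j},Z_{a,j}: 1\le a\le r,\ 1\le j\le 2n\}\cup\{X_j: 1\le j\le 2n\}$$ and edge set consisting of - $u_iv_i$ for $1\le i\le 2k+1$; - for each $1\le a\le r$, $1\le j\le 2n$ and $i\in I_a$: the edges $Y_{a,j}u_i$, $Y_{a,j}v_{2k+2-i}$, $Z_{a,j}v_i$, $Z_{a,j}u_{2k+2-i}$; - for each $1\le j\le 2n$ and $i\in M$: the edges $X_ju_i$ and $X_jv_{2k+2-i}$. (This graph is tripartite and has $r+1$ components.) Then $\chi_{la}(G_{2n}(2r+1,2s+1))=3$.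
   Context: For a graph $G$ with $q$ edges, a local antimagic labeling is a bijection $f:E(G)\to\{1,2,\dots,q\}$ such that $f^+(u)\ne f^+(v)$ for every edge $uv\in E(G)$. Here $f^+(u)=\sum_{e\ni u} f(e)$ is the sum of the labels of the edges incident to $u$. The color number of $f$ is the number of distinct values of $f^+$. The local antimagic chromatic number $\chi_{la}(G)$ is the minimum color number over all local antimagic labelings of $G$. *)

(* Defs.v *)
From HB Require Import structures.
From mathcomp Require Import all_boot.

Set Implicit Arguments.
Unset Strict Implicit.
Unset Printing Implicit Defensive.

(* A finite simple graph is a symmetric irreflexive relation on a finType. *)
Section LocalAntimagic.

Variables (T : finType) (e : rel T).

Definition edges : {set {set T}} :=
  [set d | [exists x, [exists y, e x y && (d == [set x; y])]]].

(* Only the values of [f] on [edges] matter. *)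
Definition vertex_sum (f : {set T} -> nat) (x : T) : nat :=
  \sum_(d in edges | x \in d) f d.

Definition edge_bijection (f : {set T} -> nat) : Prop :=
  {in edges &, injective f} /\
  forall m, (exists2 d, d \in edges & f d = m) <-> 1 <= m <= #|edges|.

Definition local_antimagic (f : {set T} -> nat) : Prop :=
  edge_bijection f /\ forall x y, e x y -> vertex_sum f x <> vertex_sum f y.

Definition color_number (f : {set T} -> nat) : nat :=
  size (undup [seq vertex_sum f x | x : T]).

(* The number is stated as a relation because a graph with an isolated edge
   has no local antimagic labeling. *)
Definition local_antimagic_chromatic_number (c : nat) : Prop :=
  (exists2 f, local_antimagic f & color_number f = c) /\
  forall f, local_antimagic f -> c <= color_number f.

Definition independent (A : {set T}) : Prop :=
  forall x y, x \in A -> y \in A -> ~~ e x y.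

Definition tripartite : Prop :=
  exists P : {set {set T}},
    [/\ partition P [set: T], #|P| = 3 & forall A, A \in P -> independent A].

End LocalAntimagic.

(* Ordinals count from 0: [U i] is u_(i+1), [Y a j] is Y_(a+1,j+1), etc. *)
Inductive vertex (n r k : nat) : Type :=
| U of 'I_(2 * k + 1)
| V of 'I_(2 * k + 1)
| Y of 'I_r & 'I_(2 * n)
| Z of 'I_r & 'I_(2 * n)
| X of 'I_(2 * n).

Arguments U {n r k}.
Arguments V {n r k}.
Arguments Y {n r k}.
Arguments Z {n r k}.
Arguments X {n r k}.

Section VertexFinType.

Variables n r k : nat.

Definition vertex_code (x : vertex n r k) :
    'I_(2 * k + 1) + 'I_(2 * k + 1) + 'I_r * 'I_(2 * n) + 'I_r * 'I_(2 * n)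
    + 'I_(2 * n) :=
  match x with
  | U i => inl (inl (inl (inl i)))
  | V i => inl (inl (inl (inr i)))
  | Y a j => inl (inl (inr (a, j)))
  | Z a j => inl (inr (a, j))
  | X j => inr j
  end.

Definition vertex_decode
    (c : 'I_(2 * k + 1) + 'I_(2 * k + 1) + 'I_r * 'I_(2 * n)
         + 'I_r * 'I_(2 * n) + 'I_(2 * n)) : vertex n r k :=
  match c with
  | inl (inl (inl (inl i))) => U i
  | inl (inl (inl (inr i))) => V i
  | inl (inl (inr (a, j))) => Y a j
  | inl (inr (a, j)) => Z a j
  | inr j => X j
  end.

Lemma vertex_codeK : cancel vertex_code vertex_decode.
Proof. by case. Qed.

HB.instance Definition _ := Finite.copy (vertex n r k) (can_type vertex_codeK).

End VertexFinType.

(* [block s a] holds at i when i+1 lies in the (a+1)-st interval of length 2s+1: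
   this is I_(a+1) for a < r, and M for a = r. *)
Definition block (s a i : nat) : bool :=
  a * (2 * s + 1) + 1 <= i.+1 <= a.+1 * (2 * s + 1).

(* In 0-based indexing, i |-> 2k+2-i is [rev_ord]; it is an involution, so
   v_(2k+2-i) with i in I_a ranges over the v_l with 2k+2-l in I_a. *)
Definition link (n r s k : nat) (x y : vertex n r k) : bool :=
  match x, y with
  | U i, V l => i == l
  | Y a _, U i => block s a i
  | Y a _, V l => block s a (rev_ord l)
  | Z a _, V i => block s a i
  | Z a _, U l => block s a (rev_ord l)
  | X _, U i => block s r i
  | X _, V l => block s r (rev_ord l)
  | _, _ => false
  end.

(* The graph G_{2n}(2r+1,2s+1), intended for 2k+1 = (2r+1)(2s+1). *)
Definition G (n r s k : nat) : rel (vertex n r k) :=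
  fun x y => link s x y || link s y x.

Lemma G_sym n r s k : symmetric (@G n r s k).
Proof. by move=> x y; rewrite /G orbC. Qed.

Lemma G_irrefl n r s k : irreflexive (@G n r s k).
Proof. by case. Qed.

(* Main.v *)
Require Import Defs.
From HB Require Import structures.
From mathcomp Require Import all_boot.
From mathcomp Require Import zify.

(** Every index [i] and every [j < 2n] determine one vertex [star j i] among
the [Y], [Z] and [X], joined both to [u_i] and to [v_(2k+2-i)].  The two edges of
such a pair get labels adding up to [q + 1], where [q = (2k+1)(4n+1)], so every
[star] vertex gets the sum [(2s+1)(q+1)].  Arrange the labels in [4n+1] rows of
length [2k+1]: the middle row labels the edges [u_i v_i] in order, and the labels
of the edges at the [u_i] are permuted rows, the permutations being chosen so
that all [u_i] get the same sum; complementation then makes the sums at the [v_i]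
equal as well.  If two of the three sums coincided, [q + 1] would divide
[2n(2k+1)], which is positive and smaller.  The triangle on the middle [u_i], [v_i]
and an [X_j] shows that three colors are needed. *)

Set Implicit Arguments.
Unset Strict Implicit.
Unset Printing Implicit Defensive.

(** * Generalities: labelings given by codes of indexed edges, component counts *)

Lemma set2_eq (T : finType) (x y x' y' : T) :
  [set x; y] = [set x'; y'] -> x = x' /\ y = y' \/ x = y' /\ y = x'.
Proof.
move=> E.
have: y' \in [set x; y] by rewrite E set22.
have: x' \in [set x; y] by rewrite E set21.
have: y \in [set x'; y'] by rewrite -E set22.
have: x \in [set x'; y'] by rewrite -E set21.
by do 4 case/set2P=> ?; (left; split; congruence) || (right; split; congruence).
Qed.

Section EdgeIndexing.

Variables (T : finType) (e : rel T) (I : finType).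
Variables (psi : I -> {set T}) (code : I -> nat).
Hypothesis psi_inj : injective psi.
Hypothesis psi_edges : forall d, (d \in edges e) = [exists p, psi p == d].

(** On an edge [psi p] the sum has the single term [code p], so no inverse of [psi] has to be
    chosen. *)
Definition label_of_code (d : {set T}) : nat := \sum_(p | psi p == d) code p.

Lemma label_of_codeE p : label_of_code (psi p) = code p.
Proof.
by rewrite /label_of_code (big_pred1 p) // => p'; rewrite /= (inj_eq psi_inj).
Qed.

Lemma edges_imset : edges e = psi @: [set: I].
Proof.
apply/setP=> d; rewrite psi_edges; apply/existsP/imsetP.
  by case=> p /eqP <-; exists p.
by case=> p _ ->; exists p.
Qed.

Lemma card_edges : #|edges e| = #|I|.
Proof. by rewrite edges_imset card_imset // cardsT. Qed.

Lemma vertex_sum_label_of_code x :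
  vertex_sum e label_of_code x = \sum_(p | x \in psi p) code p.
Proof.
rewrite /vertex_sum edges_imset big_imset_cond /=; last exact: in2W psi_inj.
by apply: eq_big => [p|p _]; rewrite ?inE ?label_of_codeE.
Qed.

(** Lowered by one, [code] is an injection of [I] into ['I_#|I|], a set of the same size, hence
    onto. *)
Lemma label_of_code_bijection :
    injective code -> (forall p, 1 <= code p <= #|I|) ->
  edge_bijection e label_of_code.
Proof.
move=> code_inj code_bound; split.
  move=> d d'; rewrite edges_imset => /imsetP[p _ ->] /imsetP[p' _ ->].
  by rewrite !label_of_codeE => /code_inj ->.
move=> m; rewrite card_edges; split.
  by case=> d; rewrite edges_imset => /imsetP[p _ ->]; rewrite label_of_codeE => <-.
case: m => [|m] //= lt_m.
have lt_code p : (code p).-1 < #|I| by have := code_bound p; lia.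
have ord_inj : injective (fun p => Ordinal (lt_code p)).
  move=> p p' [] eq_c; apply: code_inj.
  by have := code_bound p; have := code_bound p'; lia.
have [g _ gK] := inj_card_bij ord_inj (eq_leq (card_ord _)).
exists (psi (g (Ordinal lt_m))); first by rewrite edges_imset imset_f.
rewrite label_of_codeE; have /(congr1 val) /= := gK (Ordinal lt_m).
by have := code_bound (g (Ordinal lt_m)); lia.
Qed.

End EdgeIndexing.

(** The roots represent the components; [f] is injective on them and already takes every value
    there. *)
Lemma n_comp_invariant (T T' : finType) (e : rel T) (f : T -> T') :
    connect_sym e -> (forall x y, connect e x y = (f x == f y)) ->
    (forall t, exists x, f x = t) ->
  n_comp e predT = #|T'|.
Proof.
move=> e_sym fP f_surj.
have rootP x : root e x \in roots e by apply: roots_root.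
have fE x : f (root e x) = f x by apply/esym/eqP; rewrite -fP connect_root.
have eq_n : n_comp e predT = #|[set x in roots e]|.
  by rewrite /n_comp_mem; apply: eq_card => x; rewrite !inE /= andbT.
rewrite eq_n -(card_in_imset (f := f)).
  rewrite -cardsT; apply: eq_card=> t; rewrite inE.
  have [x <-] := f_surj t.
  by rewrite -fE imset_f // in_set rootP.
move=> x y; rewrite !inE => /eqP xr /eqP yr /eqP; rewrite -fP.
by rewrite -(root_connect e_sym) xr yr => /eqP.
Qed.

(** * Rows and columns of the label array *)

(* The rows [col k 0], [col k 1] and the identity form a Kotzig array. *)
Definition col (k j x : nat) : nat :=
  if j == 0 then (if odd x then 2 * k - x./2 else k - x./2)
  else if j == 1 then (if odd x then k - x./2.+1 else 2 * k - x./2)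
  else if odd j then 2 * k - x else x.

(** For [j < 2n] this picks exactly one row of each pair [t], [4n - t] off the middle row, and the
    rows at positions [2t], [2t + 1] add up to [4n - 1]. *)
Definition row (n j : nat) : nat := if odd j then 4 * n - j else j.

Lemma col_le k j x : x <= 2 * k -> col k j x <= 2 * k.
Proof. by rewrite /col; do !case: ifP; lia. Qed.

Lemma col_inj k j x y :
  x <= 2 * k -> y <= 2 * k -> col k j x = col k j y -> x = y.
Proof. by rewrite /col; do !case: ifP; lia. Qed.

Lemma row_le n j : j < 2 * n -> row n j <= 4 * n.
Proof. by rewrite /row; do !case: ifP; lia. Qed.

Lemma row_neq n j : j < 2 * n -> row n j <> 2 * n.
Proof. by rewrite /row; do !case: ifP; lia. Qed.

Lemma row_inj n j j' : j < 2 * n -> j' < 2 * n -> row n j = row n j' -> j = j'.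
Proof. by rewrite /row; do !case: ifP; lia. Qed.

Lemma row_add_neq n j j' : j < 2 * n -> j' < 2 * n -> row n j + row n j' <> 4 * n.
Proof. by rewrite /row; do !case: ifP; lia. Qed.

(** Positions pair up as [2t], [2t + 1]. The rows of a pair add up to [4n - 1]. The columns of the
    first pair together with the trailing [x] add up to [3k], those of each later pair to [2k], so
    [x] disappears. *)
Lemma sum_row_col n k l x : l < n -> x <= 2 * k ->
  \sum_(j < 2 * l.+1) ((2 * k + 1) * row n j + col k j x + 1) + x =
  (2 * k + 1) * (l.+1 * (4 * n - 1)) + 2 * l.+1 + (2 * l + 3) * k.
Proof.
move=> lt_ln le_x; elim: l lt_ln => [|l IHl] lt_ln.
  by rewrite !big_ord_recr big_ord0 /= /row /col /=; case: ifP; nia.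
have [t tE] : exists t, t = 2 * l.+1 by exists (2 * l.+1).
have -> : 2 * l.+2 = t.+2 by lia.
rewrite !big_ord_recr /=.
have := IHl (ltnW lt_ln); rewrite -tE => {}IHl.
have -> : row n t = t by rewrite /row; case: ifP; lia.
have -> : row n t.+1 = 4 * n - t.+1 by rewrite /row; case: ifP; lia.
have -> : col k t x = x by rewrite /col; do !case: ifP; lia.
have -> : col k t.+1 x = 2 * k - x by rewrite /col; do !case: ifP; lia.
have eq_rows : (2 * k + 1) * t + (2 * k + 1) * (4 * n - t.+1) =
    (2 * k + 1) * (4 * n - 1) by rewrite -mulnDr; congr (_ * _); lia.
move: (4 * n - 1) (4 * n - _) (\sum_(_ < _) _) IHl eq_rows => m d S.
by lia.
Qed.

(** * Fibers, invariants of connectedness, and digits *)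

Lemma fiber_partition (T T' : finType) (f : T -> T') :
    (forall t, exists x, f x = t) ->
  let P := [set f @^-1: [set t] | t : T'] in
  partition P [set: T] /\ #|P| = #|T'|.
Proof.
move=> f_surj P; have fib_inj : injective (fun t => f @^-1: [set t]).
  move=> t t' /setP; have [x <-] := f_surj t.
  by move/(_ x); rewrite !inE eqxx => /esym/eqP.
split; last by rewrite card_imset.
apply/and3P; split.
- apply/eqP/setP=> x; rewrite inE; apply/bigcupP.
  by exists (f @^-1: [set f x]); rewrite ?imset_f // !inE.
- apply/trivIsetP=> _ _ /imsetP[t _ ->] /imsetP[t' _ ->] neq.
  rewrite -setI_eq0; apply/eqP/setP=> x; rewrite !inE.
  by apply/andP=> -[/eqP tE /eqP tE']; rewrite -tE -tE' eqxx in neq.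
- apply/imsetP=> -[t _ /setP]; have [x <-] := f_surj t.
  by move/(_ x); rewrite !inE eqxx.
Qed.

Lemma connect_invariant (T : finType) (T' : eqType) (e : rel T) (f : T -> T') x y :
  (forall x y, e x y -> f x = f y) -> connect e x y -> f x = f y.
Proof.
move=> fE /connectP[p]; elim: p x => [|z p IHp] x /=; first by move=> _ ->.
by case/andP=> /fE -> e_p /IHp ->.
Qed.

Lemma digits_inj b x y c d :
  c < b -> d < b -> b * x + c = b * y + d -> x = y /\ c = d.
Proof.
move=> lt_c lt_d E; have b_gt0 : 0 < b by apply: leq_ltn_trans lt_c.
have := congr1 (divn^~ b) E; have := congr1 (modn^~ b) E.
rewrite /= ![b * _]mulnC !modnMDl !divnMDl //.
by rewrite !modn_small // !divn_small // !addn0.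
Qed.

Lemma mulD_neq_mul x y z q : 0 < y < q -> x * q + y <> z * q.
Proof.
case/andP=> y_gt0 lt_yq /(congr1 (modn^~ q)).
by rewrite /= modnMDl modnMl modn_small //; lia.
Qed.

(** * Blocks of indices and the star vertices *)

Section Construction.

Variables n r s k : nat.
Hypotheses (n_gt0 : 0 < n) (hk : 2 * k + 1 = (2 * r + 1) * (2 * s + 1)).

Notation m := (2 * s + 1).
Notation N := (2 * k + 1).
Notation vtx := (vertex n r k).
Implicit Types (i l : 'I_N) (j : 'I_(2 * n)) (a : 'I_r).

Lemma blockE (a : nat) i : block s a i = (i %/ m == a).
Proof.
have m_gt0 : 0 < m by rewrite addn1.
by rewrite eqn_leq -ltnS ltn_divLR // leq_divRL // andbC /block addn1.
Qed.

Lemma quo_le i : i %/ m <= 2 * r.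
Proof. have m_gt0 : 0 < m by rewrite addn1.
by rewrite -ltnS ltn_divLR // -[(2 * r).+1]addn1 -hk. Qed.

Lemma rev_ordE i : rev_ord i = 2 * k - i :> nat.
Proof. by rewrite /rev_ord /=; lia. Qed.

Lemma quo_rev i : rev_ord i %/ m = 2 * r - i %/ m.
Proof.
have le_q := quo_le i; have lt_i := ltn_ord i.
rewrite rev_ordE; have := divn_eq i m; have : i %% m < m by rewrite ltn_mod addn1.
move: (i %/ m) (i %% m) le_q => q t le_q lt_t iE.
(* With [i = q * m + t] and [2k = 2r * m + 2s], reversal complements both the quotient and the
   remainder. *)
have -> : 2 * k - i = (2 * r - q) * m + (2 * s - t) by rewrite mulnBl; nia.
by rewrite divnMDl ?addn1 // divn_small ?addn0 //; lia.
Qed.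

(** The quotients of [i] and of its reverse add up to [2r], so at most one [insub] into ['I_r]
    succeeds, and both fail exactly at quotient [r]. *)
Definition star j i : vtx :=
  if insub (i %/ m) is Some a then Y a j
  else if insub (rev_ord i %/ m) is Some a then Z a j else X j.

Variant star_spec j i : vtx -> Prop :=
| StarY a of i %/ m = a : star_spec j i (Y a j)
| StarZ a of rev_ord i %/ m = a : star_spec j i (Z a j)
| StarX of i %/ m = r : star_spec j i (X j).

Lemma starP j i : star_spec j i (star j i).
Proof.
rewrite /star; case: insubP => [a _ /esym aE|]; first exact: StarY.
case: insubP => [a _ /esym aE _|]; first exact: StarZ.
by rewrite quo_rev => ? ?; apply: StarX; have := quo_le i; lia.
Qed.

Lemma star_Y j i a : i %/ m = a -> star j i = Y a j.
Proof. by move=> iE; rewrite /star iE valK. Qed.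

Lemma star_Z j i a : rev_ord i %/ m = a -> star j i = Z a j.
Proof.
move=> iE; have iE' := iE; rewrite quo_rev in iE'.
have lt_a := ltn_ord a; have le_q := quo_le i.
by rewrite /star insubN ?iE ?valK // -leqNgt; lia.
Qed.

Lemma star_X j i : i %/ m = r -> star j i = X j.
Proof.
move=> iE; rewrite /star !insubN ?quo_rev ?iE ?ltnn //.
by rewrite -leqNgt; lia.
Qed.

(** The constructor tells whether the quotient is below, above or equal to [r], and its index
    recovers the quotient. Hence the indices sharing a star vertex form one block. *)
Lemma star_eq j j' i i' :
  (star j i == star j' i') = (j == j') && (i %/ m == i' %/ m).
Proof.
have [le_q le_q'] := (quo_le i, quo_le i').
apply/eqP/andP => [|[/eqP <- /eqP eq_q]].
  case: (starP j i) => [a|a|]; rewrite ?quo_rev => iE;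
  case: (starP j' i') => [a'|a'|]; rewrite ?quo_rev => iE' // [].
  - by move=> aE ->; split=> //; rewrite iE iE' aE.
  - move=> aE ->; split=> //; apply/eqP; have := congr1 val aE => /=.
    by have := ltn_ord a; lia.
  - by move=> ->; split=> //; rewrite iE iE'.
by rewrite /star !quo_rev eq_q.
Qed.

(** * The edges as an indexed family *)

Definition edge_index : Type := ('I_N + 'I_(2 * n) * 'I_N * bool)%type.
HB.instance Definition _ := Finite.on edge_index.

(** The reversal at [V] makes [leaf i false] and [leaf i true] neighbors of the same [star j i];
    these two edges will get complementary labels. *)
Definition leaf i (b : bool) : vtx := if b then V (rev_ord i) else U i.

Definition edge_of (p : edge_index) : {set vtx} :=
  match p with
  | inl i => [set U i; V i]
  | inr (j, i, b) => [set star j i; leaf i b]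
  end.

Lemma link_star_leaf j i b : link s (star j i) (leaf i b).
Proof.
rewrite /leaf; case: b; case: starP => [a|a|] iE;
  by rewrite /link ?rev_ordK blockE ?iE ?quo_rev // iE; apply/eqP; lia.
Qed.

Variant link_spec : vtx -> vtx -> Prop :=
| LinkUV i : link_spec (U i) (V i)
| LinkStar j i b : link_spec (star j i) (leaf i b).

(** Reduces the seven kinds of edges to two. *)
Lemma linkP x y : link s x y -> link_spec x y.
Proof.
case: x y => [i|i|a j|a j|j] [l|l|a' j'|a' j'|j'] //.
all: rewrite /link ?blockE => /eqP E.
- by rewrite E; apply: LinkUV.
- by rewrite -(star_Y j E); apply: (LinkStar j l false).
- by rewrite -(star_Y j E) -{2}[l]rev_ordK; apply: (LinkStar j _ true).
- by rewrite -(star_Z j E); apply: (LinkStar j l false).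
- rewrite -(@star_Z j (rev_ord l) a) ?rev_ordK // -{2}[l]rev_ordK.
  exact: (LinkStar j _ true).
- by rewrite -(star_X j E); apply: (LinkStar j l false).
- by rewrite -(star_X j E) -{2}[l]rev_ordK; apply: (LinkStar j _ true).
Qed.

Lemma edges_G d : (d \in edges (@G n r s k)) = [exists p, edge_of p == d].
Proof.
rewrite inE; apply/existsP/existsP => [[x /existsP[y]]|[p /eqP <-]].
  case/andP=> Gxy /eqP ->; wlog: x y Gxy / link s x y.
    by case/orP: (Gxy) => link_xy; [|rewrite setUC]; apply; rewrite // G_sym.
  by move/linkP; case=> [i|j i b]; [exists (inl i)|exists (inr (j, i, b))].
case: p => [i|[[j i] b]].
  by exists (U i); apply/existsP; exists (V i); rewrite /G /= !eqxx.
exists (star j i); apply/existsP; exists (leaf i b).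
by rewrite /G link_star_leaf /=.
Qed.

Lemma leaf_inj i i' b b' : leaf i b = leaf i' b' -> (i, b) = (i', b').
Proof.
case: b b' => [] [] // E; last by case: E => ->.
by have /rev_ord_inj -> : rev_ord i = rev_ord i' by move: E; rewrite /leaf; congruence.
Qed.

Lemma star_neq_leaf j i i' b : star j i <> leaf i' b.
Proof. by case: b; case: starP. Qed.

Lemma edge_of_inj : injective edge_of.
Proof.
case=> [i|[[j i] b]] [i'|[[j' i'] b']] /set2_eq [] [] //.
- by case=> ->.
- by move=> /esym/(@star_neq_leaf _ _ _ false).
(* [V i] is [leaf (rev_ord i) true], so it is no star vertex. *)
- by move=> _ /esym; rewrite -[i]rev_ordK => /(@star_neq_leaf _ _ _ true).
- by move/(@star_neq_leaf _ _ _ false).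
- by rewrite -[i']rev_ordK => /(@star_neq_leaf _ _ _ true).
- by move/eqP; rewrite star_eq => /andP[/eqP -> _] /leaf_inj [-> ->].
- by move/star_neq_leaf.
Qed.

(** * The labels *)

(* Written in base [2 * k + 1], the label minus one has digits [erow p] and
   [ecol p]; complementing both digits sends a label to [q + 1 - label]. *)
Definition erow (p : edge_index) : nat :=
  match p with
  | inl _ => 2 * n
  | inr (j, _, b) => if b then 4 * n - row n j else row n j
  end.

Definition ecol (p : edge_index) : nat :=
  match p with
  | inl i => i
  | inr (j, i, b) => if b then 2 * k - col k j i else col k j i
  end.

Definition code (p : edge_index) : nat := N * erow p + ecol p + 1.

Definition label : {set vtx} -> nat := label_of_code edge_of code.

Lemma ord_le i : i <= 2 * k.
Proof. by have := ltn_ord i; lia. Qed.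

Lemma erow_le p : erow p <= 4 * n.
Proof.
case: p => [i|[[j i] b]] /=; first by lia.
by have := row_le (ltn_ord j); case: b; lia.
Qed.

Lemma ecol_le p : ecol p <= 2 * k.
Proof.
case: p => [i|[[j i] b]] /=; first exact: ord_le.
by have := col_le j (ord_le i); case: b; lia.
Qed.

(** Only the edges [u_i v_i] use the middle row ([row_neq]), and complemented rows avoid the
    uncomplemented ones ([row_add_neq]). Within one row the column determines the index by
    [col_inj]. *)
Lemma code_inj : injective code.
Proof.
move=> p p' /addIn eq_c.
have [eq_r eq_col] : erow p = erow p' /\ ecol p = ecol p'.
  have lt_c q : ecol q < N by rewrite addn1 ltnS ecol_le.
  exact: digits_inj (lt_c p) (lt_c p') eq_c.
case: p p' eq_r eq_col {eq_c} => [i|[[j i] b]] [i'|[[j' i'] b']] /=.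
- by move=> _ /ord_inj ->.
- move=> E; have := row_neq (ltn_ord j'); have := row_le (ltn_ord j').
  by case: b' E; lia.
- move=> E; have := row_neq (ltn_ord j); have := row_le (ltn_ord j).
  by case: b E; lia.
have [lt_j lt_j'] := (ltn_ord j, ltn_ord j').
have := row_add_neq lt_j lt_j'; have := row_le lt_j; have := row_le lt_j'.
move=> le_r' le_r neq_r.
have := col_le j (ord_le i); have := col_le j' (ord_le i') => le_c' le_c.
case: b; case: b' => eq_r; try lia.
all: have jj' : j = j' by apply/ord_inj/(row_inj lt_j lt_j'); lia.
all: move=> eq_c; rewrite -{}jj' in le_c' eq_c *; congr (inr (_, _, _)).
all: by apply/ord_inj/(@col_inj k j) => //; first [exact: ord_le | lia].
Qed.

Lemma card_edge_index : #|{: edge_index}| = N * (4 * n + 1).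
Proof. by rewrite card_sum !card_prod card_bool !card_ord; nia. Qed.

Lemma code_bound p : 1 <= code p <= #|{: edge_index}|.
Proof.
rewrite card_edge_index /code; have := erow_le p; have := ecol_le p.
by nia.
Qed.

Lemma label_bijection : edge_bijection (@G n r s k) label.
Proof.
exact: (label_of_code_bijection edge_of_inj edges_G code_inj code_bound).
Qed.

(** * Vertex sums *)

Lemma vertex_sum_leaf i b :
  vertex_sum (@G n r s k) label (leaf i b) =
  code (inl (if b then rev_ord i else i)) + \sum_j code (inr (j, i, b)).
Proof.
rewrite (vertex_sum_label_of_code code edge_of_inj edges_G) big_sumType /=.
congr (_ + _).
  apply: big_pred1 => i'; apply/set2P/eqP; rewrite /leaf.
    by case: b => -[]; congruence.
  by move->; case: b; [right|left].
rewrite (reindex_onto (fun j => (j, i, b)) (fun q => q.1.1)) /=.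
  apply: eq_bigl => j; rewrite eqxx andbT !inE eqxx orbT //.
case=> [[j i'] b'] /= /set2P[/esym/star_neq_leaf|/leaf_inj [-> ->]] //.
Qed.

Lemma card_block (c : nat) : c <= 2 * r -> #|[pred i : 'I_N | i %/ m == c]| = m.
Proof.
move=> le_c; have lt_N (t : 'I_m) : c * m + t < N.
  by have := ltn_ord t; rewrite hk; nia.
have f_inj : injective (fun t => Ordinal (lt_N t)).
  by move=> t t' [] /addnI /ord_inj.
rewrite -[RHS]card_ord -(card_codom f_inj); apply: eq_card => i.
have m_gt0 : 0 < m by lia.
rewrite inE; apply/eqP/codomP => [iE|[t ->]]; last first.
  by rewrite /= divnMDl // divn_small // addn0.
have lt_t : i %% m < m by rewrite ltn_mod.
by exists (Ordinal lt_t); apply: ord_inj; rewrite /= -iE -divn_eq.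
Qed.

Lemma code_compl j i :
  code (inr (j, i, false)) + code (inr (j, i, true)) = N * (4 * n + 1) + 1.
Proof.
rewrite /code /=; have := col_le j (ord_le i); have := row_le (ltn_ord j).
by move: (row _ _) (col _ _ _) => x y le_x le_y; nia.
Qed.

(** No edge [u_i v_i] meets a star vertex. The edges that do come in complementary pairs, one for
    each of the [m] indices in the block of [i]. *)
Lemma vertex_sum_star j i :
  vertex_sum (@G n r s k) label (star j i) = m * (N * (4 * n + 1) + 1).
Proof.
rewrite (vertex_sum_label_of_code code edge_of_inj edges_G) big_sumType /=.
rewrite big_pred0 => [|i']; last first.
  by rewrite !inE; case: starP.
rewrite add0n (reindex_onto (fun q => (j, q.1, q.2)) (fun q => (q.1.2, q.2))) /=.
  rewrite (eq_bigl (fun q : 'I_N * bool => (q.1 %/ m == i %/ m) && true)).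
    rewrite -(pair_big (fun i' : 'I_N => i' %/ m == i %/ m) xpredT
                       (fun i' b => code (inr (j, i', b)))) /=.
    rewrite (eq_bigr (fun=> N * (4 * n + 1) + 1)).
      by rewrite sum_nat_const card_block // quo_le.
    by move=> i' _; rewrite big_bool /= addnC code_compl.
  case=> i' b; rewrite eqxx andbT !inE star_eq eqxx /= andbT eq_sym.
  by rewrite -[RHS]orbF; congr (_ || _); apply/eqP/star_neq_leaf.
case=> [[j' i'] b] /= /set2P[/eqP|/star_neq_leaf //].
by rewrite star_eq => /andP[/eqP -> _].
Qed.

(** Doubling, and putting [2 * n * N] on the left, avoids halves and truncated subtraction. The
    column digit of the edge [u_i v_i] supplies the trailing [x] of [sum_row_col]. *)
Lemma double_sum_U i :
  2 * vertex_sum (@G n r s k) label (U i) + 2 * n * N =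
  (2 * n + 1) * (N * (4 * n + 1) + 1).
Proof.
rewrite -[U i]/(leaf i false) vertex_sum_leaf /code /=.
have lt_n : n.-1 < n by lia.
have := sum_row_col lt_n (ord_le i); rewrite prednK //.
move: (\sum_(_ < _) _) => S; have [d nE] : exists d, n = d.+1 by exists n.-1; lia.
have -> : 4 * n - 1 = 4 * d + 3 by lia.
by rewrite nE /=; nia.
Qed.

Lemma double_sum_V i :
  2 * vertex_sum (@G n r s k) label (V i) =
  (2 * n + 1) * (N * (4 * n + 1) + 1) + 2 * n * N.
Proof.
rewrite -[i]rev_ordK; move: (rev_ord i) => {}i.
(* The labels at [U i] and at [V (rev_ord i)] pair off into complements, including the two
   middle-row labels, whose columns are [i] and [2k - i]. *)
have compl : vertex_sum (@G n r s k) label (U i) +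
    vertex_sum (@G n r s k) label (V (rev_ord i)) =
    (2 * n + 1) * (N * (4 * n + 1) + 1).
  rewrite -[U i]/(leaf i false) -[V _]/(leaf i true) !vertex_sum_leaf.
  rewrite addnACA -big_split /= (eq_bigr (fun=> N * (4 * n + 1) + 1)).
    rewrite sum_nat_const card_ord /code /= -/(rev_ord i).
    by have := rev_ordE i; have := ord_le i; nia.
  by move=> j _; apply: code_compl.
have := double_sum_U i; lia.
Qed.

Variant vertex_spec : vtx -> Prop :=
| VertexLeaf i b : vertex_spec (leaf i b)
| VertexStar j i : vertex_spec (star j i).

Lemma ex_quo q : q <= 2 * r -> exists i, i %/ m = q.
Proof.
move/card_block=> card_q; have /card_gt0P[i] : 0 < #|[pred i : 'I_N | i %/ m == q]|.
  by rewrite card_q; lia.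
by rewrite inE => /eqP iE; exists i.
Qed.

(** Holds because no block is empty; it leaves only the vertices whose sums are computed above. *)
Lemma vertexP x : vertex_spec x.
Proof.
case: x => [i|i|a j|a j|j]; first exact: (VertexLeaf i false).
- by rewrite -[i]rev_ordK; apply: (VertexLeaf _ true).
- have [|i iE] := @ex_quo a; first by have := ltn_ord a; lia.
  by rewrite -(star_Y j iE); apply: VertexStar.
(* The reverse of [i] must lie in block [a], so [i] itself has quotient [2r - a]. *)
- have [|i iE] := @ex_quo (2 * r - a); first by lia.
  rewrite -(@star_Z j i a); first exact: VertexStar.
  by rewrite quo_rev iE; have := ltn_ord a; lia.
- have [|i iE] := @ex_quo r; first by lia.
  by rewrite -(star_X j iE); apply: VertexStar.
Qed.

Lemma mid_proof : k < N. Proof. by lia. Qed.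
(** Counting from 0, [k] is the fixed point of reversal, so [U mid] and [V mid] are adjacent and
    both joined to [star j mid]. *)
Definition mid : 'I_N := Ordinal mid_proof.

Lemma j0_proof : 0 < 2 * n. Proof. by lia. Qed.
Definition j0 : 'I_(2 * n) := Ordinal j0_proof.

Lemma G_invariant (A : Type) (f : vtx -> A) :
    (forall i, f (U i) = f (V i)) ->
    (forall j i b, f (star j i) = f (leaf i b)) ->
  forall x y, G s x y -> f x = f y.
Proof. by move=> fUV fstar x y /orP[] /linkP[]. Qed.

Lemma G_star_leaf j i b : G s (star j i) (leaf i b).
Proof. by rewrite /G link_star_leaf. Qed.

Lemma G_UV i : G s (U i : vtx) (V i).
Proof. by rewrite /G /= eqxx. Qed.

(** * Tripartiteness *)

Definition side (x : vtx) : 'I_3 :=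
  match x with U _ => inord 0 | V _ => inord 1 | _ => inord 2 end.

Lemma side_star j i : side (star j i) = inord 2.
Proof. by case: starP. Qed.

Lemma side_leaf i b : side (leaf i b) = inord b.
Proof. by case: b. Qed.

Lemma side_neq x y : G s x y -> side x != side y.
Proof.
wlog: x y / link s x y.
  move=> H Gxy; case/orP: (Gxy) => link_xy; first exact: H.
  by rewrite eq_sym H // G_sym.
move/linkP=> xy _; apply/eqP; case: xy => [i|j i b].
  by move/(congr1 val); rewrite /= !inordK.
by move/(congr1 val); rewrite side_star side_leaf /= !inordK //; case: b.
Qed.

Lemma G_tripartite : tripartite (@G n r s k).
Proof.
have side_surj t : exists x, side x = t.
  have t_of : t = inord (val t) by rewrite inord_val.
  rewrite t_of; case: t {t_of} => -[|[|[|//]]] /= _.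
  - by exists (U mid).
  - by exists (V mid).
  - by exists (X j0).
have [P_part cardP] := fiber_partition side_surj.
exists [set side @^-1: [set t] | t : 'I_3]; split=> //; first by rewrite cardP card_ord.
move=> _ /imsetP[t _ ->] x y; rewrite !inE => /eqP xE /eqP yE.
by apply/negP=> /side_neq; rewrite xE yE eqxx.
Qed.

(** * Distinct sums and the number of colors *)

Lemma double_sum_neq :
  (2 * m) * (N * (4 * n + 1) + 1) + 2 * n * N <>
    (2 * n + 1) * (N * (4 * n + 1) + 1) /\
  2 * m * (N * (4 * n + 1) + 1) <>
    (2 * n + 1) * (N * (4 * n + 1) + 1) + 2 * n * N.
Proof.
have [Q QE] : exists Q, Q = N * (4 * n + 1) + 1 by eexists.
have [y yE] : exists y, y = 2 * n * N by eexists.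
rewrite -QE -yE; have [y_gt0 lt_yQ] : 0 < y /\ y < Q by rewrite QE yE; nia.
by split; last apply/nesym; apply: mulD_neq_mul; rewrite y_gt0.
Qed.

(** The sums at [U] and [V] differ by [2 * n * N > 0]. A star sum is separated from either one by
    doubling and comparing modulo [q + 1]. *)
Lemma sum_neq i i' j :
  let w := vertex_sum (@G n r s k) label in
  [/\ w (U i) <> w (V i'), w (star j i) <> w (U i') & w (star j i) <> w (V i')].
Proof.
move=> w; have := double_sum_U i; have := double_sum_U i'.
have := double_sum_V i'; have := vertex_sum_star j i.
rewrite -/w; have [] := double_sum_neq.
have : 0 < 2 * n * N by nia.
move: (N * (4 * n + 1) + 1) (2 * n * N) => Q y y_gt0.
rewrite -!mulnA; move: (m * Q) ((2 * n + 1) * Q) => *; split; lia.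
Qed.

Lemma label_antimagic : local_antimagic (@G n r s k) label.
Proof.
split; first exact: label_bijection.
move=> x y; wlog: x y / link s x y.
  move=> H Gxy; case/orP: (Gxy) => link_xy; first exact: H.
  by apply/nesym/H; rewrite // G_sym.
move/linkP=> [i|j i b] _; first by have [] := sum_neq i i j0.
by case: b; [have [] := sum_neq i (rev_ord i) j|have [] := sum_neq i i j].
Qed.

Lemma color_number_label : color_number (@G n r s k) label = 3.
Proof.
set w := vertex_sum (@G n r s k) label.
have [neqUV neqSU neqSV] := sum_neq mid mid j0; rewrite -/w in neqUV neqSU neqSV.
have wU i : w (U i) = w (U mid).
  by have := double_sum_U i; have := double_sum_U mid; rewrite -/w; lia.
have wV i : w (V i) = w (V mid).
  by have := double_sum_V i; have := double_sum_V mid; rewrite -/w; lia.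
have wS j i : w (star j i) = w (star j0 mid) by rewrite /w !vertex_sum_star.
have vals : [seq w x | x : vtx] =i [:: w (U mid); w (V mid); w (star j0 mid)].
  move=> c; rewrite !inE; apply/imageP/or3P => [[x _ ->]|].
    case: (vertexP x) => [i b|j i]; last by rewrite wS; constructor 3.
    by case: b; rewrite /leaf ?wU ?wV; [constructor 2|constructor 1].
  by case=> /eqP ->; [exists (U mid)|exists (V mid)|exists (star j0 mid)].
rewrite /color_number (perm_size (perm_undup vals)) undup_id //=.
rewrite !inE negb_or andbT -andbA.
by apply/and3P; split; apply/eqP; congruence.
Qed.

Lemma color_number_ge3 f : local_antimagic (@G n r s k) f ->
  3 <= color_number (@G n r s k) f.
Proof.
case=> _; set w := vertex_sum (@G n r s k) f => w_neq.
have rev_mid : rev_ord mid = mid.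
  by apply: ord_inj; rewrite rev_ordE /=; lia.
have neqUV := w_neq _ _ (G_UV mid).
have neqSU := w_neq _ _ (G_star_leaf j0 mid false).
have := w_neq _ _ (G_star_leaf j0 mid true); rewrite /leaf rev_mid => neqSV.
apply: (@uniq_leq_size _ [:: w (U mid); w (V mid); w (star j0 mid)]).
  rewrite /leaf in neqSU; rewrite /= !inE negb_or andbT -andbA.
  by apply/and3P; split; apply/eqP; congruence.
move=> c; rewrite mem_undup !inE => /or3P[] /eqP ->; exact: image_f.
Qed.

(** * Connected components *)

Definition quo_min i : nat := minn (i %/ m) (rev_ord i %/ m).

(** Reversal exchanges the quotients [q] and [2r - q], so their minimum is constant along edges and
    lies between 0 and [r]. *)
Definition component (x : vtx) : 'I_r.+1 :=
  match x with
  | U i | V i => inord (quo_min i)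
  | Y a _ | Z a _ => inord a
  | X _ => inord r
  end.

Lemma component_leaf i b : component (leaf i b) = inord (quo_min i).
Proof. by case: b; rewrite //= -/(rev_ord i) /quo_min rev_ordK minnC. Qed.

Lemma component_star j i : component (star j i) = inord (quo_min i).
Proof.
have le_q := quo_le i; rewrite /quo_min.
case: starP => [a|a|]; rewrite quo_rev => iE /=; congr inord.
- by have := ltn_ord a; lia.
- by have := ltn_ord a; lia.
- by lia.
Qed.

Lemma quo_min_le i : quo_min i <= r.
Proof. by rewrite /quo_min quo_rev; have := quo_le i; lia. Qed.

Lemma G_connect_sym : connect_sym (@G n r s k).
Proof. exact/sym_connect_sym/G_sym. Qed.

Lemma connect_star_leaf j i b : connect (@G n r s k) (star j i) (leaf i b).
Proof. exact/connect1/G_star_leaf. Qed.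

(** Gives each component a canonical representative: two star vertices over [j0] with equal
    quotients coincide. *)
Lemma connect_star_quo_min x :
  exists2 i : 'I_N, i %/ m = component x & connect (@G n r s k) x (star j0 i).
Proof.
have [i xE xi] : exists2 i, component x = inord (quo_min i) &
    connect (@G n r s k) x (star j0 i).
  case: (vertexP x) => [i b|j i]; exists i.
  - exact: component_leaf.
  - by rewrite G_connect_sym connect_star_leaf.
  - exact: component_star.
  - apply: connect_trans (connect_star_leaf j i false) _.
    by rewrite G_connect_sym connect_star_leaf.
(* The path runs from [star j0 i] through [U i] and [V i] to [star j0 (rev_ord i)]; it allows
   passing to the smaller quotient. *)
have i_rev : connect (@G n r s k) (star j0 i) (star j0 (rev_ord i)).
  apply: connect_trans (connect_star_leaf j0 i false) _.
  apply: connect_trans (connect1 (G_UV i)) _.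
  rewrite G_connect_sym -{2}[i]rev_ordK.
  exact: (connect_star_leaf j0 (rev_ord i) true).
have vE : component x = quo_min i :> nat by rewrite xE inordK // ltnS quo_min_le.
have [le_q|lt_q] := leqP (i %/ m) (rev_ord i %/ m).
  by exists i; rewrite // vE /quo_min (minn_idPl le_q).
exists (rev_ord i); last exact: connect_trans xi i_rev.
by rewrite vE /quo_min (minn_idPr (ltnW lt_q)).
Qed.

Lemma connectE x y : connect (@G n r s k) x y = (component x == component y).
Proof.
apply/idP/eqP.
  apply: connect_invariant; apply: G_invariant => [//|j i b].
  by rewrite component_star component_leaf.
have [i iE xi] := connect_star_quo_min x; have [i' iE' yi'] := connect_star_quo_min y.
move=> eq_c; apply: connect_trans xi _; rewrite G_connect_sym.
have /eqP -> // : star j0 i == star j0 i' by rewrite star_eq iE iE' eq_c !eqxx.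
Qed.

Lemma n_comp_G : n_comp (@G n r s k) predT = r + 1.
Proof.
rewrite addn1 -[RHS]card_ord.
apply: (n_comp_invariant G_connect_sym connectE) => t.
(* Since [t <= r], the minimum of [t] and [2r - t] is [t]. *)
have [|i iE] := @ex_quo t; first by have := ltn_ord t; lia.
exists (star j0 i); rewrite component_star -[RHS]inord_val; congr inord.
by rewrite /quo_min quo_rev iE; have := ltn_ord t; lia.
Qed.

End Construction.

Theorem theorem2p2 (n r s k : nat) (hn : 1 <= n) (hr : 1 <= r) (hs : 1 <= s)
    (hk : 2 * k + 1 = (2 * r + 1) * (2 * s + 1)) :
  [/\ tripartite (@G n r s k),
      n_comp (@G n r s k) predT = r + 1 &
      local_antimagic_chromatic_number (@G n r s k) 3].
Proof.
split; [exact: G_tripartite | exact: n_comp_G | split].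
  by exists (@label n r s k); [apply: label_antimagic | apply: color_number_label].
by move=> f; apply: color_number_ge3.
Qed.
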